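(* Let $F$ be a finite field of characteristic two, let $n>2$ be an integer, and let $C_{2^n}=\langle a\rangle$ be the cyclic group of order $2^n$. Let $\sigma_4$ be the $F$-linear involution of $FC_{2^n}$ extending the group automorphism $a\mapsto a^{2^{n-1}+1}$. Then $V_{\sigma_4}(FC_{2^n})$ is an elementary abelian group (i.e. an elementary abelian $2$-group) of order $|F|^{2^{n-1}}$.
   Context: $FG$ denotes the group algebra of $G$ over $F$, and $V(FG)$ is the group of normalized units, i.e. units of $FG$ whose augmentation (sum of coefficients) equals $1$. For an involution $\sigma$ of $FG$, the unitary subgroup is $V_{\sigma}(FG)=\{u\in V(FG) : u^{\sigma}=u^{-1}\}$. *)

(* Defs.v *)
From HB Require Import structures.
From mathcomp Require Import all_boot all_order all_fingroup all_algebra.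
From mathcomp Require Import all_solvable.

Set Implicit Arguments.
Unset Strict Implicit.
Unset Printing Implicit Defensive.

Import GroupScope GRing.Theory.
Local Open Scope ring_scope.

(* The group algebra FG.  The alias keeps the convolution product apart from  *)
(* the pointwise product that {ffun gT -> F} canonically carries.             *)
Definition galg (F : finFieldType) (gT : finGroupType) : Type :=
  {ffun gT -> F}.

Section GroupAlgebra.
Variables (F : finFieldType) (gT : finGroupType).
Local Notation FG := (galg F gT).
Implicit Types (x y z : FG) (g h k : gT).

HB.instance Definition _ := Finite.copy FG {ffun gT -> F}.
HB.instance Definition _ := GRing.Zmodule.copy FG {ffun gT -> F}.
HB.instance Definition _ := GRing.Lmodule.copy FG {ffun gT -> F^o}.

Definition galg_coef x g : F := (x : {ffun gT -> F}) g.

Definition gdelta g : FG := [ffun h => (h == g)%:R].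

Definition galg_mul x y : FG :=
  [ffun g => \sum_h galg_coef x h * galg_coef y (h^-1 * g)%g].

Lemma galgP x y : (forall g, galg_coef x g = galg_coef y g) -> x = y.
Proof. by move=> eqxy; apply/ffunP. Qed.

Lemma galg_coefD x y g :
  galg_coef (x + y) g = galg_coef x g + galg_coef y g.
Proof. exact: ffunE. Qed.

Lemma galg_coefZ (c : F) x g : galg_coef (c *: x) g = c * galg_coef x g.
Proof. exact: ffunE. Qed.

Lemma galg_coef0 g : galg_coef 0 g = 0.
Proof. exact: ffunE. Qed.

Lemma galg_coef_delta g h : galg_coef (gdelta g) h = (h == g)%:R.
Proof. exact: ffunE. Qed.

Lemma galg_coef_mul x y g :
  galg_coef (galg_mul x y) g
    = \sum_h galg_coef x h * galg_coef y (h^-1 * g)%g.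
Proof. exact: ffunE. Qed.

Lemma galg_coef_sum I (r : seq I) (P : pred I) (E : I -> FG) g :
  galg_coef (\sum_(i <- r | P i) E i) g
    = \sum_(i <- r | P i) galg_coef (E i) g.
Proof.
by apply: (big_morph (galg_coef^~ g)) => [x y|];
  rewrite ?galg_coefD ?galg_coef0.
Qed.

Fact galg_mulA : associative galg_mul.
Proof.
move=> x y z; apply: galgP => g; rewrite !galg_coef_mul.
under eq_bigr do rewrite galg_coef_mul big_distrr /=.
under [RHS]eq_bigr do rewrite galg_coef_mul big_distrl /=.
rewrite [RHS]exchange_big /=; apply: eq_bigr => h _.
rewrite [RHS](reindex_inj (mulgI h)) /=; apply: eq_bigr => k _.
by rewrite mulKg invMg mulgA mulrA.
Qed.

Fact galg_mul1 : left_id (gdelta 1) galg_mul.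
Proof.
move=> x; apply: galgP => g; rewrite galg_coef_mul (bigD1 1%g) //=.
rewrite galg_coef_delta eqxx mul1r invg1 mul1g big1 ?addr0 // => h h1.
by rewrite galg_coef_delta (negPf h1) mul0r.
Qed.

Fact galg_mulr1 : right_id (gdelta 1) galg_mul.
Proof.
move=> x; apply: galgP => g; rewrite galg_coef_mul (bigD1 g) //=.
rewrite galg_coef_delta mulVg eqxx mulr1 big1 ?addr0 // => h hg.
rewrite galg_coef_delta (_ : _ == 1%g = false) ?mulr0 //.
by apply: contraNF hg => /eqP/(canRL (mulKVg h)) ->; rewrite mulg1.
Qed.

Fact galg_mulDl : left_distributive galg_mul +%R.
Proof.
move=> x y z; apply: galgP => g; rewrite galg_coefD !galg_coef_mul -big_split.
by apply: eq_bigr => h _; rewrite galg_coefD mulrDl.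
Qed.

Fact galg_mulDr : right_distributive galg_mul +%R.
Proof.
move=> x y z; apply: galgP => g; rewrite galg_coefD !galg_coef_mul -big_split.
by apply: eq_bigr => h _; rewrite galg_coefD mulrDr.
Qed.

Fact galg_1neq0 : gdelta 1 != 0.
Proof.
apply/eqP => /(congr1 (galg_coef^~ 1%g)); rewrite galg_coef_delta eqxx galg_coef0.
by move/eqP; rewrite oner_eq0.
Qed.

HB.instance Definition _ := GRing.Zmodule_isNzRing.Build FG
  galg_mulA galg_mul1 galg_mulr1 galg_mulDl galg_mulDr galg_1neq0.

Fact galg_scaleAl (c : F) x y : c *: (x * y) = (c *: x) * y.
Proof.
apply: galgP => g; rewrite galg_coefZ !galg_coef_mul big_distrr /=.
by apply: eq_bigr => h _; rewrite galg_coefZ mulrA.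
Qed.

Fact galg_scaleAr (c : F) x y : c *: (x * y) = x * (c *: y).
Proof.
apply: galgP => g; rewrite galg_coefZ !galg_coef_mul big_distrr /=.
by apply: eq_bigr => h _; rewrite galg_coefZ mulrCA.
Qed.

HB.instance Definition _ :=
  GRing.Lmodule_isLalgebra.Build F FG galg_scaleAl.
HB.instance Definition _ := GRing.Lalgebra_isAlgebra.Build F FG galg_scaleAr.
HB.instance Definition _ := FinRing.isNzRing.Build FG.

Definition augmentation x : F := \sum_g galg_coef x g.

Definition normalized_units : {set {unit FG}} :=
  [set u | augmentation (val u) == 1].

(* No condition is put on sigma, so that this is a priori only a set.         *)
Definition unitary_subgroup (sigma : FG -> FG) : {set {unit FG}} :=
  [set u in normalized_units | sigma (val u) == val u^-1%g].

Definition galg_lin (f : gT -> gT) x : FG :=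
  \sum_g galg_coef x g *: gdelta (f g).

Fact galg_lin_is_linear f : linear (galg_lin f).
Proof.
move=> c x y; rewrite /galg_lin scaler_sumr -big_split /=.
by apply: eq_bigr => g _; rewrite galg_coefD galg_coefZ scalerDl scalerA.
Qed.

HB.instance Definition _ f :=
  GRing.isLinear.Build F FG FG _ (galg_lin f) (galg_lin_is_linear f).

Lemma galg_lin_delta f g : galg_lin f (gdelta g) = gdelta (f g).
Proof.
rewrite /galg_lin (bigD1 g) //= galg_coef_delta eqxx scale1r big1 ?addr0 //.
by move=> h hg; rewrite galg_coef_delta (negPf hg) scale0r.
Qed.

Lemma galg_coef_lin (phi : {perm gT}) x g :
  galg_coef (galg_lin phi x) (phi g) = galg_coef x g.
Proof.
rewrite galg_coef_sum (bigD1 g) //= galg_coefZ galg_coef_delta eqxx mulr1.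
rewrite big1 ?addr0 // => h hg; rewrite galg_coefZ galg_coef_delta.
by rewrite (inj_eq perm_inj) eq_sym (negPf hg) mulr0.
Qed.

Lemma galg_linM (phi : {perm gT}) x y : phi \in Aut [set: gT] ->
  galg_lin phi (x * y) = galg_lin phi x * galg_lin phi y.
Proof.
move=> autphi; have phiM g h : phi (g * h)%g = (phi g * phi h)%g.
  by rewrite -!(autmE autphi) morphM ?inE.
have phiV g : phi g^-1%g = (phi g)^-1%g.
  by rewrite -!(autmE autphi) morphV ?inE.
apply: galgP => g; rewrite -[g](permKV phi) galg_coef_lin !galg_coef_mul.
rewrite [RHS](reindex_inj (@perm_inj _ phi)) /=; apply: eq_bigr => h _.
by rewrite -phiV -phiM !galg_coef_lin.
Qed.

End GroupAlgebra.

(* Main.v *)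
Require Import Defs.
From mathcomp Require Import all_boot all_order all_fingroup all_algebra.
From mathcomp Require Import all_solvable.
From mathcomp Require Import zify.

Import GroupScope GRing.Theory.
Local Open Scope ring_scope.

Set Implicit Arguments.
Unset Strict Implicit.
Unset Printing Implicit Defensive.

(** Write z for the involution a^(2^(n-1)), so that phi sends g to g or to g z
according as g is an even or an odd power of a.  The point is that a unit u is
unitary exactly when u^2 = 1 ([unitary_twist_Ldiv2]); both assertions of the
theorem then follow easily.

In characteristic 2 squaring is additive on the commutative algebra FG, so the
coefficient of x^2 at k^2 is the sum of the x_g^2 over the square roots g of
k^2, which are k and k z ([galg_coef_sqr_sqr]).  Hence x^2 = 0 if and only if x
is invariant under translation by z ([galg_sqr_eq0]), and u^2 = 1 if and only
if u + 1 is.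

If u^2 = 1, then u_{kz} = u_k for every odd k, because 1 has no coefficient
there; this says that sigma fixes u, so that sigma(u) = u = u^-1.

Conversely let u sigma(u) = 1, and let p and q be the even and odd parts of u.
Then sigma(u) = p + q z, so that p^2 + q^2 z + p q (1 + z) = 1.  Compare
coefficients at k^2 z for k odd.  Since z = y^2 with y = a^(2^(n-2)), and y is
even because n > 2, the square roots of k^2 z = (k y)^2 are odd; hence p^2 and
1 contribute nothing, nor does p q (1 + z), whose support is odd.  What remains
is (q_k + q_{kz})^2 = 0, so sigma fixes u, and u^2 = u sigma(u) = 1
([twist_unitary_odd]).

The solutions of u^2 = 1 are 1 + x with x constant on the cosets of <z>, which
makes |F|^(2^n / 2) of them ([card_Ldiv2_galg]). *)

(** * Arithmetic of the group algebra *)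

Section GroupAlgebra.
Variables (F : finFieldType) (gT : finGroupType).
Local Notation FG := (galg F gT).
Implicit Types (x y u : FG) (g h k : gT).

Lemma galg_coef1 g : galg_coef (1 : FG) g = (g == 1%g)%:R.
Proof. exact: galg_coef_delta. Qed.

Lemma galg_expand x : x = \sum_g galg_coef x g *: gdelta F g.
Proof.
apply: galgP => k; rewrite galg_coef_sum (bigD1 k) //= galg_coefZ.
rewrite galg_coef_delta eqxx mulr1 big1 ?addr0 // => g gk.
by rewrite galg_coefZ galg_coef_delta eq_sym (negPf gk) mulr0.
Qed.

Lemma gdeltaM g h : gdelta F g * gdelta F h = gdelta F (g * h)%g.
Proof.
apply: galgP => k; rewrite galg_coef_mul (bigD1 g) //= big1 => [|l lg].
  rewrite !galg_coef_delta eqxx mul1r addr0.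
  by rewrite -(inj_eq (mulgI g)) mulKVg.
by rewrite galg_coef_delta (negPf lg) mul0r.
Qed.

Lemma galg_coef_mul_gdelta x g k :
  galg_coef (x * gdelta F g) k = galg_coef x (k * g^-1)%g.
Proof.
rewrite galg_coef_mul (bigD1 (k * g^-1)%g) //= big1 => [|h hkg].
  by rewrite galg_coef_delta invMg invgK mulgKV eqxx mulr1 addr0.
rewrite galg_coef_delta -(inj_eq (mulgI h)) mulKVg.
by rewrite -(inj_eq (mulIg g^-1%g)) mulgK eq_sym (negPf hkg) mulr0.
Qed.

Lemma augmentationM : {morph @augmentation F gT : x y / x * y}.
Proof.
move=> x y; rewrite /augmentation.
under eq_bigr do rewrite galg_coef_mul.
rewrite exchange_big /= mulr_suml; apply: eq_bigr => h _.
rewrite -mulr_sumr; congr (_ * _).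
by rewrite [RHS](reindex_inj (mulgI h^-1%g)).
Qed.

Lemma augmentation1 : augmentation (1 : FG) = 1.
Proof.
rewrite /augmentation (bigD1 1%g) //= big1 => [|g g1].
  by rewrite galg_coef1 eqxx addr0.
by rewrite galg_coef1 (negPf g1).
Qed.

(** A Z-invariant element is a function on the quotient group. *)
Lemma card_galg_invariants (Z : {group gT}) : Z <| [set: gT] ->
  #|[set x : FG | [forall g, forall z in Z,
       galg_coef x (g * z)%g == galg_coef x g]]|
    = (#|F| ^ #|[set: gT] : Z|)%N.
Proof.
move=> /andP[_ nZG].
pose lift (c : {ffun coset_of Z -> F}) : FG := [ffun g => c (coset Z g)].
have liftE c g : galg_coef (lift c) g = c (coset Z g) by exact: ffunE.
have lift_inj : injective lift.
  move=> c d eq_cd; apply/ffunP => B.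
  by rewrite -[B]coset_reprK -!liftE eq_cd.
have -> : [set x : FG | [forall g, forall z in Z,
              galg_coef x (g * z)%g == galg_coef x g]] = lift @: setT.
  apply/setP => x; rewrite inE; apply/idP/imsetP => [/forallP inv_x | [c _ ->]].
    exists [ffun B : coset_of Z => galg_coef x (repr B)] => //.
    apply: galgP => g; rewrite liftE ffunE.
    have nZg : g \in 'N(Z) by rewrite (subsetP nZG) ?inE.
    rewrite val_coset // norm_rlcoset //.
    have /lcosetP[z Zz ->] := mem_repr g (lcoset_refl Z g).
    by apply/esym/eqP; apply: (implyP (forallP (inv_x g) z)).
  apply/forallP => g; apply/forallP => z; apply/implyP => Zz.
  by rewrite !liftE coset_kerr.
rewrite card_imset // cardsT card_ffun -card_quotient //.
congr (_ ^ _)%N; rewrite -cardsT; apply: eq_card => B; rewrite !inE.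
have [g Ng ->] := cosetP B.
by rewrite mem_quotient ?inE.
Qed.

(** * Squares in characteristic two *)

Hypothesis charF2 : 2%N \in [pchar F].

Lemma galg_pchar2 : 2%N \in [pchar FG].
Proof.
by rewrite inE /= -(scaler_nat 2 (1 : FG)) (pcharf0 charF2) scale0r.
Qed.

Hypothesis abelG : abelian [set: gT].

Lemma mulgTC g h : (g * h = h * g)%g.
Proof. by apply: (centsP abelG); rewrite inE. Qed.

Lemma galg_mulC x y : x * y = y * x.
Proof.
apply: galgP => g; rewrite !galg_coef_mul.
rewrite (reindex_inj invg_inj) (reindex_inj (mulIg g^-1%g)) /=.
apply: eq_bigr => h _; rewrite mulrC invgK mulgKV invMg invgK.
by rewrite (mulgTC g).
Qed.

Lemma galg_sqrD x y : (x + y) ^+ 2 = x ^+ 2 + y ^+ 2.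
Proof.
rewrite -!(pFrobenius_autE galg_pchar2) pFrobenius_autD_comm //.
exact: galg_mulC.
Qed.

Lemma galg_sqrE x :
  x ^+ 2 = \sum_g galg_coef x g ^+ 2 *: gdelta F (g ^+ 2)%g.
Proof.
rewrite {1}[x]galg_expand.
rewrite (big_morph (fun y : FG => y ^+ 2) galg_sqrD (expr0n _ 2)).
by apply: eq_bigr => g _; rewrite exprZn [gdelta _ _ ^+ 2]expr2 gdeltaM.
Qed.

Lemma galg_coef_sqr x k :
  galg_coef (x ^+ 2) k = \sum_(g | (g ^+ 2)%g == k) galg_coef x g ^+ 2.
Proof.
rewrite galg_sqrE galg_coef_sum [RHS]big_mkcond; apply: eq_bigr => g _.
by rewrite galg_coefZ galg_coef_delta eq_sym; case: eqP; rewrite ?mulr1 ?mulr0.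
Qed.

(** The kernel of the squaring map depends only on the square roots of 1 in the
group; the case of interest is that 1 has a single nontrivial one. *)
Section UniqueInvolution.
Variable z : gT.
Hypothesis z_neq1 : z != 1%g.
Hypothesis sqrg_eq1 : forall g, ((g ^+ 2)%g == 1%g) = (g == 1%g) || (g == z).

Lemma galg_coef_sqr_sqr x k :
  galg_coef (x ^+ 2) (k ^+ 2)%g = (galg_coef x k + galg_coef x (k * z)%g) ^+ 2.
Proof.
have sqr_eq g : ((g ^+ 2)%g == (k ^+ 2)%g) = (g == k) || (g == k * z)%g.
  transitivity ((k^-1 * g) ^+ 2 == 1)%g.
    by rewrite expgMn ?expgVn -?eq_mulVg1 1?eq_sym //; exact: mulgTC.
  by rewrite sqrg_eq1 -eq_mulVg1 (eq_sym k) -[_ == z](inj_eq (mulgI k)) mulKVg.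
have kzk : (k * z)%g != k by rewrite -[X in _ != X]mulg1 (inj_eq (mulgI k)).
rewrite galg_coef_sqr (bigD1 k) //= (bigD1 (k * z)%g) /=; last first.
  by rewrite sqr_eq eqxx orbT.
rewrite big1 ?addr0 => [|g].
  by rewrite -!(pFrobenius_autE charF2) rmorphD.
by rewrite sqr_eq -andbA; case: (g == k); case: (g == _).
Qed.

(** Squares of group elements are the only places where x^2 can have a
coefficient, so the values at all k^2 decide whether x^2 vanishes. *)
Lemma galg_sqr_eq0 x :
  reflect (forall g, galg_coef x (g * z)%g = galg_coef x g) (x ^+ 2 == 0).
Proof.
have eq_addF (b c : F) : (b == c) = (c + b == 0).
  by rewrite -subr_eq0 oppr_pchar2 // addrC.
apply: (iffP eqP) => [x2_0 g | inv_x].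
  apply/eqP; rewrite eq_addF -sqrf_eq0 -galg_coef_sqr_sqr x2_0.
  by rewrite galg_coef0.
apply: galgP => k; rewrite galg_coef0.
have [/existsP[g /eqP <-]|no_root] := boolP [exists g, (g ^+ 2)%g == k].
  by rewrite galg_coef_sqr_sqr inv_x addrr_pchar2 // expr0n.
rewrite galg_coef_sqr big1 // => g g2k.
by case/existsP: no_root; exists g.
Qed.

Lemma galg_sqr_eq1 x :
  reflect (forall g, galg_coef (x + 1) (g * z)%g = galg_coef (x + 1) g)
          (x ^+ 2 == 1).
Proof.
suff -> : (x ^+ 2 == 1) = ((x + 1) ^+ 2 == 0) by exact: galg_sqr_eq0.
by rewrite galg_sqrD expr1n addr_eq0 (oppr_pchar2 galg_pchar2).
Qed.

Lemma card_galg_sqr_eq1 :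
  #|[set x : FG | x ^+ 2 == 1]| = (#|F| ^ #|[set: gT] : <[z]>|%g)%N.
Proof.
have nZ : <[z]> <| [set: gT].
  by rewrite -sub_abelian_normal // subsetT.
rewrite -card_galg_invariants // -[RHS](card_imset _ (addIr 1)).
apply: eq_card => x; rewrite inE.
apply/galg_sqr_eq1/imsetP => [inv_x | [y]].
  exists (x + 1); last by rewrite -addrA (addrr_pchar2 galg_pchar2) addr0.
  rewrite inE; apply/forallP => g; apply/forallP => h; apply/implyP.
  case/cycleP=> i ->; apply/eqP; elim: i => [|i IHi]; first by rewrite mulg1.
  by rewrite expgSr mulgA inv_x.
rewrite inE => /forallP inv_y -> g.
rewrite -addrA (addrr_pchar2 galg_pchar2) addr0.
by apply/eqP/(implyP (forallP (inv_y g) z))/cycle_id.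
Qed.

Lemma card_Ldiv2_galg :
  #|('Ldiv_2() : {set {unit FG}})| = (#|F| ^ #|[set: gT] : <[z]>|%g)%N.
Proof.
rewrite -card_galg_sqr_eq1 -(card_imset _ val_inj).
apply: eq_card => x; rewrite inE; apply/imsetP/eqP => [[u] | x2_1].
  by rewrite inE => /eqP u2_1 ->; rewrite -FinRing.val_unitX u2_1.
have Ux : x \is a GRing.unit by apply/unitrP; exists x; rewrite -expr2.
exists (FinRing.unit FG Ux) => //; rewrite inE; apply/eqP/val_inj.
by rewrite FinRing.val_unitX.
Qed.

(** * Unitary units for a twist by the involution *)

(** The twist phi moves g by an element of <z>.  The root y of z that phi fixes
exists in the cyclic group of order 2^n only for n > 2, and without it the
conclusion fails: for n = 2 the generator a is a unitary unit of order 4. *)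
Section Twist.
Variables (phi : {perm gT}) (y : gT).
Hypothesis phi_aut : phi \in Aut [set: gT].
Hypothesis phi_twist : forall g, phi g = g \/ phi g = (g * z)%g.
Hypothesis phi_y : phi y = y.
Hypothesis y_sqr : (y ^+ 2)%g = z.

Local Notation even g := (phi g == g).
Local Notation sigma := (@galg_lin F gT phi).

Let phiM g h : phi (g * h)%g = (phi g * phi h)%g.
Proof. by rewrite -!(autmE phi_aut) morphM ?inE. Qed.

Let phiV g : phi g^-1%g = (phi g)^-1%g.
Proof. by rewrite -!(autmE phi_aut) morphV ?inE. Qed.

Let zz : (z * z = 1)%g.
Proof.
by have /eqP : (z ^+ 2)%g == 1%g by rewrite sqrg_eq1 eqxx orbT.
Qed.

Let evenM g h : even h -> even (g * h)%g = even g.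
Proof. by move=> /eqP eh; rewrite phiM eh (inj_eq (mulIg h)). Qed.

Let even_z : even z.
Proof. by rewrite -y_sqr expgS expg1 evenM phi_y. Qed.

Let oddP g : ~~ even g -> phi g = (g * z)%g.
Proof. by case: (phi_twist g) => -> //; rewrite eqxx. Qed.

Let even_sqr g : even (g ^+ 2)%g.
Proof.
rewrite expgS expg1 phiM; case: (phi_twist g) => -> //.
by rewrite mulgA -(mulgA g) (mulgTC z) mulgA -(mulgA _ z) zz mulg1.
Qed.

Let phiK g : phi (phi g) = g.
Proof.
have [/eqP eg | /oddP og] := boolP (even g); first by rewrite !eg.
by rewrite {1}og phiM og (eqP even_z) -mulgA zz mulg1.
Qed.

Lemma galg_coef_twist x g : galg_coef (sigma x) g = galg_coef x (phi g).
Proof. by rewrite -{1}[g]phiK galg_coef_lin. Qed.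

Lemma twist_fixed x :
  (forall g, ~~ even g -> galg_coef x (g * z)%g = galg_coef x g) ->
  sigma x = x.
Proof.
move=> inv_x; apply: galgP => g; rewrite galg_coef_twist.
have [/eqP -> // | og] := boolP (even g).
by rewrite oddP ?inv_x.
Qed.

(* The decomposition of FG along the fixed subgroup of phi and its complement. *)
Let even_part x : FG := [ffun g => if even g then galg_coef x g else 0].
Let odd_part x : FG := [ffun g => if even g then 0 else galg_coef x g].

Let even_partE x g :
  galg_coef (even_part x) g = if even g then galg_coef x g else 0.
Proof. exact: ffunE. Qed.

Let odd_partE x g :
  galg_coef (odd_part x) g = if even g then 0 else galg_coef x g.
Proof. exact: ffunE. Qed.

Let partsD x : even_part x + odd_part x = x.
Proof.
apply: galgP => g; rewrite galg_coefD even_partE odd_partE.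
by case: ifP; rewrite ?addr0 ?add0r.
Qed.

Let twist_parts x : sigma x = even_part x + odd_part x * gdelta F z.
Proof.
have Vz : (z^-1 = z)%g by apply/eqP; rewrite eq_invg_mul zz.
apply: galgP => g.
rewrite galg_coef_twist galg_coefD galg_coef_mul_gdelta Vz even_partE odd_partE.
rewrite evenM //.
have [/eqP eg | og] := boolP (even g); first by rewrite eg addr0.
by rewrite oddP // add0r.
Qed.

(** With p and q the even and odd parts of x, the coefficients at g^2 z of
p^2 + q^2 z + p q (1 + z) = 1 all vanish except the one of q^2 z: the element
g^2 z is even, while p q is odd, and g^2 z = (g y)^2 where g y is odd, so that
neither an even element nor 1 contributes to it. *)
Lemma twist_unitary_odd x g : x * sigma x = 1 -> ~~ even g ->
  galg_coef x (g * z)%g = galg_coef x g.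
Proof.
set p := even_part x; set q := odd_part x => x_unitary og.
have eq1 : p ^+ 2 + q ^+ 2 * gdelta F z + p * q * (1 + gdelta F z) = 1.
  rewrite -[RHS]x_unitary twist_parts -/p -/q -{1}[x]partsD -/p -/q.
  rewrite [RHS]mulrDl !mulrDr mulr1 !mulrA (galg_mulC q p) !expr2.
  by rewrite addrACA [RHS]addrACA [X in _ + X]addrC.
have pq_even k : even k -> galg_coef (p * q) k = 0.
  move=> ek; rewrite galg_coef_mul big1 // => h _; rewrite even_partE odd_partE.
  have [eh|] := boolP (even h); last by rewrite mul0r.
  by rewrite evenM // phiV (eqP eh) eqxx mulr0.
have p_odd h : ~~ even h -> galg_coef p h = 0.
  by move=> oh; rewrite even_partE (negPf oh).
have oddMz h : even (h * z)%g = even h by exact: evenM.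
have gyz : ((g * y) ^+ 2 = g ^+ 2 * z)%g.
  by rewrite expgMn ?y_sqr //; exact: mulgTC.
have := congr1 (fun w : FG => galg_coef w (g ^+ 2 * z)%g) eq1.
rewrite !galg_coefD mulrDr mulr1 galg_coefD !galg_coef_mul_gdelta mulgK.
rewrite !pq_even ?oddMz // !addr0.
rewrite -{1}gyz !galg_coef_sqr_sqr.
rewrite !p_odd ?oddMz ?evenM ?phi_y // addr0 expr0n add0r.
rewrite galg_coef1 -gyz sqrg_eq1.
(* The coefficient of 1 at (g y)^2 vanishes, since 1 and z are even. *)
have ogy : ~~ even (g * y)%g by rewrite evenM ?phi_y.
have /negPf-> : (g * y)%g != 1%g.
  by apply: contraNneq ogy => ->; rewrite -(evenM _ even_z) mul1g.
have /negPf-> : (g * y)%g != z by apply: contraNneq ogy => ->.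
move/eqP; rewrite sqrf_eq0 !odd_partE oddMz (negPf og).
by rewrite addrC addr_eq0 oppr_pchar2 // => /eqP.
Qed.

(** Both conditions on u are equivalent to sigma(u) = u = u^-1.  A square root
of 1 is normalized, because its augmentation is a square root of 1 in F. *)
Theorem unitary_twist_Ldiv2 : unitary_subgroup sigma = 'Ldiv_2().
Proof.
apply/setP => u; rewrite !inE.
apply/andP/eqP => [[_ /eqP u_unitary] | u2_1].
  apply/val_inj; rewrite FinRing.val_unitX.
  have u_sigma : val u * sigma (val u) = 1.
    by rewrite u_unitary -FinRing.val_unitM mulgV.
  rewrite expr2 -{2}[val u]twist_fixed // => g og.
  exact: twist_unitary_odd.
have val_u2 : val u ^+ 2 = 1 by rewrite -FinRing.val_unitX u2_1.
split.
  have := congr1 (@augmentation F gT) val_u2.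
  rewrite expr2 augmentationM augmentation1 -expr2 => /eqP.
  by rewrite sqrf_eq1 oppr_pchar2 // orbb.
have /eqP Vu : (u^-1 == u)%g by rewrite eq_invg_mul; apply/eqP.
rewrite Vu; apply/eqP/twist_fixed => g og.
have /galg_sqr_eq1/(_ g) := introT eqP val_u2.
have coef1_odd h : ~~ even h -> galg_coef (1 : FG) h = 0.
  move=> oh; rewrite galg_coef1; case: eqP => // h1; case/negP: oh.
  by rewrite h1 -(evenM _ even_z) mul1g.
by rewrite !galg_coefD !coef1_odd ?evenM // !addr0.
Qed.

End Twist.
End UniqueInvolution.
End GroupAlgebra.

Theorem lemma5 (F : finFieldType) (charF2 : 2%N \in [pchar F])
    (n : nat) (n_gt2 : (2 < n)%N)
    (gT : finGroupType) (a : gT)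
    (genG : [set: gT] = <[a]>%g) (ord_a : #[a]%g = (2 ^ n)%N)
    (phi : {perm gT}) (phi_aut : phi \in Aut [set: gT])
    (phi_a : phi a = (a ^+ (2 ^ (n - 1) + 1)%N)%g) :
  let V := @unitary_subgroup F gT (galg_lin phi) in
  [/\ group_set V, (2.-abelem V)%g & #|V| = (#|F| ^ (2 ^ (n - 1)))%N].
Proof.
set M := (2 ^ (n - 1))%N.
pose z : gT := (a ^+ M)%g; pose y : gT := (a ^+ (2 ^ (n - 2)))%g.
have ord_aE : #[a]%g = (M * 2)%N by rewrite ord_a /M -expnSr; congr expn; lia.
have M_gt0 : (0 < M)%N by rewrite expn_gt0.
have abelG : abelian [set: gT] by rewrite genG cycle_abelian.
have aP g : exists2 i, (i < M * 2)%N & g = (a ^+ i)%g.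
  have /cyclePmin[i i_lt ->] : g \in <[a]>%g by rewrite -genG inE.
  by exists i; rewrite -?ord_aE.
have z_sqr : (z ^+ 2 = 1)%g by rewrite -expgM -ord_aE expg_order.
have z_neq1 : z != 1%g.
  rewrite -order_dvdn ord_aE; apply/negP => /(dvdn_leq M_gt0).
  by rewrite leqNgt ltn_Pmulr.
have sqrg_eq1 g : ((g ^+ 2)%g == 1%g) = (g == 1%g) || (g == z).
  apply/eqP/orP => [|[]/eqP-> //]; last by rewrite expg1n.
  have [i i_lt ->] := aP g => ai2_1.
  have /dvdnP[q def_i] : (M %| i)%N.
    by rewrite -(@dvdn_pmul2r 2) // -ord_aE order_dvdn expgM ai2_1.
  move: i_lt; rewrite def_i [(q * M)%N]mulnC ltn_pmul2l //.
  case: q def_i => [|[|//]] def_i _; first by left; rewrite muln0.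
  by right; rewrite muln1.
have phiE i : phi (a ^+ i)%g = (a ^+ i * z ^+ i)%g.
  have -> : phi (a ^+ i)%g = (phi a ^+ i)%g.
    by rewrite -!(autmE phi_aut) morphX ?inE.
  by rewrite phi_a -!expgM -expgD mulnDl mul1n addnC.
have phi_twist g : phi g = g \/ phi g = (g * z)%g.
  have [i _ ->] := aP g; rewrite phiE.
  have -> : (z ^+ i = z ^+ odd i)%g.
    by rewrite -{1}(odd_double_half i) -mul2n expgD expgM z_sqr expg1n mulg1.
  by case: (odd i); [right | left; rewrite mulg1].
have phi_y : phi y = y.
  (* phi y = y z^(2^(n-2)), whose exponent is even because n > 2. *)
  rewrite /y; have -> : (n - 2 = (n - 3).+1)%N by lia.
  by rewrite phiE expnS (expgM z) z_sqr expg1n mulg1.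
have y_sqr : (y ^+ 2 = z)%g.
  by rewrite -expgM -expnSr; congr (a ^+ (2 ^ _))%g; lia.
move=> V.
have defV : V = 'Ldiv_2() by exact: unitary_twist_Ldiv2 phi_y y_sqr.
have abelU : abelian [set: {unit (galg F gT)}].
  by apply/centsP => u _ v _; apply: val_inj; exact: galg_mulC.
have V_gr : group_set V.
  by rewrite defV -[X in group_set X]setTI; exact: group_Ldiv.
split=> //.
  rewrite -[V]/(gval (Group V_gr)) abelemE //.
  rewrite (abelianS (subsetT _) abelU) /=.
  by rewrite -sub_LdivT defV.
rewrite defV (card_Ldiv2_galg charF2 abelG z_neq1 sqrg_eq1); congr (_ ^ _)%N.
have card_G : #|[set: gT]| = (M * 2)%N by rewrite genG -orderE.
have ord_z : #[z]%g = 2%N by rewrite orderXdiv ord_aE ?dvdn_mulr // mulKn.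
by rewrite -divgS ?subsetT //= card_G -orderE ord_z mulnK.
Qed.
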